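(* Let $\alpha,\beta,r>0$ and, for $K>0$, let $g(K)=\big(\alpha+\frac{\beta}{K^2}\big)(K+r)$. Then for all real $K>0$, $g(K)\ge\max\{\alpha r,\,2\sqrt{\alpha\beta}\}$. For $K_0=\sqrt{\beta/\alpha}$, $$g(K_0)=2\sqrt{\alpha\beta}+2\alpha r\ \le\ 3\min_{K>0}g(K).$$
   Context: In the paper, $g(K)$ is (up to a common factor) the upper bound on a weighted oracle cost, $r$ is the ratio of the costs of the two oracles, and $\alpha,\beta$ are positive constants of the order of a dimension $m$ and a condition number $\kappa$ respectively. Only positivity of $\alpha,\beta,r$ is used. *)

(* Defs.v *)
(* MathComp-Analysis, over an arbitrary model [R : realType] of the reals *)
From mathcomp Require Import all_boot all_order all_algebra.
From mathcomp Require Import all_classical all_reals.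

Set Implicit Arguments.
Unset Strict Implicit.
Unset Printing Implicit Defensive.

Import Order.TTheory GRing.Theory Num.Theory.
Local Open Scope classical_set_scope.
Local Open Scope ring_scope.

Definition g (R : realType) (alpha beta r K : R) : R :=
  (alpha + beta / K ^+ 2) * (K + r).

(* [m] is the minimum of [A]; unlike for [inf], membership makes it attained *)
Definition is_min (R : realType) (A : set R) (m : R) : Prop :=
  A m /\ lbound A m.

(* Main.v *)
(* The critical points of [g] on the positive axis are the positive roots of
   [alpha K^3 = beta (K + 2 r)]. Such a root [c] exists by the intermediate
   value theorem, and [g K - g c] is [(K - c)^2] times a positive factor, so [c]
   is a global minimizer. The ratio bound adds [2 sqrt (alpha beta) <= g c] to
   twice [alpha r <= g c]. *)
Require Import Defs.
From mathcomp Require Import all_boot all_order all_algebra.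
From mathcomp Require Import all_classical all_reals.
From mathcomp Require Import ring lra.

Set Implicit Arguments.
Unset Strict Implicit.
Unset Printing Implicit Defensive.

Import Order.TTheory GRing.Theory Num.Theory.
Local Open Scope classical_set_scope.
Local Open Scope ring_scope.

Lemma g_ge_mul (R : realType) (alpha beta r K : R) :
  0 <= alpha -> 0 <= beta -> 0 <= r -> 0 < K -> alpha * r <= g alpha beta r K.
Proof.
move=> a0 b0 r0 K0; rewrite /g.
apply: ler_pM => //; first by rewrite lerDl divr_ge0 // exprn_ge0 // ltW.
by rewrite lerDr ltW.
Qed.

(** AM-GM on [alpha * K + beta / K], the part of the product free of [r]: its excess over the bound
    is a square divided by [K], and the part carrying [r] is nonnegative. *)
Lemma g_ge_sqrt (R : realType) (alpha beta r K : R) :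
  0 <= alpha -> 0 <= beta -> 0 <= r -> 0 < K ->
  2 * Num.sqrt (alpha * beta) <= g alpha beta r K.
Proof.
move=> a0 b0 r0 K0; rewrite /g sqrtrM //.
rewrite -{2}(sqr_sqrtr a0) -{2}(sqr_sqrtr b0).
set a := Num.sqrt alpha; set b := Num.sqrt beta.
have Kn0 : K != 0 by rewrite gt_eqF.
rewrite -subr_ge0.
have -> : (a ^+ 2 + b ^+ 2 / K ^+ 2) * (K + r) - 2 * (a * b) =
    (a * K - b) ^+ 2 / K + (a ^+ 2 + b ^+ 2 / K ^+ 2) * r by field.
apply: addr_ge0; first by rewrite divr_ge0 ?sqr_ge0 // ltW.
by rewrite mulr_ge0 // addr_ge0 ?divr_ge0 ?sqr_ge0.
Qed.

(** This [K] balances the first factor: [beta / K ^+ 2 = alpha], so [g] becomes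
    [2 * alpha * (K + r)]. *)
Lemma g_sqrt_ratio (R : realType) (alpha beta r : R) :
  0 < alpha -> 0 < beta ->
  g alpha beta r (Num.sqrt (beta / alpha)) =
  2 * Num.sqrt (alpha * beta) + 2 * alpha * r.
Proof.
move=> a0 b0; rewrite /g !sqrtrM ?(ltW a0) ?(ltW b0) // sqrtrV ?(ltW a0) //.
have an0 : Num.sqrt alpha != 0 by rewrite gt_eqF // sqrtr_gt0.
have bn0 : Num.sqrt beta != 0 by rewrite gt_eqF // sqrtr_gt0.
have aE := esym (sqr_sqrtr (ltW a0)); have bE := esym (sqr_sqrtr (ltW b0)).
(* With the roots abstracted and [alpha], [beta] replaced by their squares, a rational identity
   remains. *)
move: (Num.sqrt alpha) (Num.sqrt beta) an0 bn0 aE bE => a b an0 bn0 -> ->.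
by field; rewrite an0 bn0.
Qed.

Lemma g_critical_exists (R : realType) (alpha beta r : R) :
  0 < alpha -> 0 < beta -> 0 < r ->
  exists2 c : R, 0 < c & alpha * c ^+ 3 = beta * (c + 2 * r).
Proof.
move=> a0 b0 r0.
pose p : {poly R} := alpha *: 'X^3 - beta *: ('X + (2 * r)%:P).
have pE x : p.[x] = alpha * x ^+ 3 - beta * (x + 2 * r) by rewrite !hornerE.
(* A Cauchy-type root bound: [t] is the sum of the lower coefficients over the leading one, and [p]
   is nonnegative at [1 + t]. *)
pose t := (beta + 2 * beta * r) / alpha.
have br0 : 0 < beta * r by rewrite mulr_gt0.
have t0 : 0 <= t by rewrite divr_ge0 ?ltW //; lra.
have at_ : alpha * t = beta + 2 * beta * r by rewrite mulrC divfK ?gt_eqF.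
clearbody t; pose B := 1 + t.
have B0 : 0 <= B by rewrite addr_ge0.
have p0 : p.[0] <= 0 by rewrite pE; lra.
have pB : 0 <= p.[B].
  have -> : p.[B] = alpha * B ^+ 2 + alpha * t * B ^+ 2 - beta * (B + 2 * r).
    by rewrite pE /B; ring.
  rewrite at_.
  (* As [B - 1 = t], the differences [B ^+ 2 - B] and [B ^+ 2 - 1] are [t * B] and [t * (2 + t)]. *)
  have -> : alpha * B ^+ 2 + (beta + 2 * beta * r) * B ^+ 2
      - beta * (B + 2 * r) =
      alpha * B ^+ 2 + beta * (t * B) + 2 * (beta * r) * (t * (2 + t)).
    by rewrite /B; ring.
  have [age0 bge0] := (ltW a0, ltW b0).
  have t2 : 0 <= t * (2 + t) by rewrite mulr_ge0 // addr_ge0.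
  have tB : 0 <= beta * (t * B) by rewrite !mulr_ge0.
  have aB : 0 <= alpha * B ^+ 2 by rewrite mulr_ge0 ?sqr_ge0.
  by rewrite addr_ge0 ?(addr_ge0 aB tB) // mulr_ge0 // mulr_ge0 // ltW.
have [c /andP[c0 _] /rootP pc] := poly_ivt B0 (introT andP (conj p0 pB)).
exists c; last by apply/eqP; rewrite -subr_eq0 -pE pc.
(* The root is not [0], since [p.[0] = - 2 * beta * r] is negative. *)
rewrite lt_neqAle c0 andbT; apply/eqP => c00.
by move: pc; rewrite -c00 pE; lra.
Qed.

Lemma g_critical_le (R : realType) (alpha beta r c K : R) :
  0 <= beta -> 0 <= r -> 0 < c -> 0 < K ->
  alpha * c ^+ 3 = beta * (c + 2 * r) ->
  g alpha beta r c <= g alpha beta r K.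
Proof.
move=> b0 r0 c0 K0 crit.
have cn0 : c != 0 by rewrite gt_eqF.
have Kn0 : K != 0 by rewrite gt_eqF.
(* Eliminating [alpha] builds the critical equation into the difference, which makes [c] a double
   root in [K]. *)
have -> : alpha = beta * (c + 2 * r) / c ^+ 3.
  by rewrite -crit mulfK // expf_neq0.
rewrite -subr_ge0 /g.
set d := (X in 0 <= X).
have -> : d = beta * (K - c) ^+ 2 * (K * c + r * (2 * K + c))
    / (K ^+ 2 * c ^+ 3) by rewrite /d; field; rewrite cn0 Kn0.
have [cge0 Kge0] := (ltW c0, ltW K0).
have Kc : 0 <= K * c + r * (2 * K + c) by rewrite !(addr_ge0, mulr_ge0).
apply: divr_ge0; first exact: mulr_ge0 (mulr_ge0 b0 (sqr_ge0 _)) Kc.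
by rewrite mulr_ge0 ?exprn_ge0.
Qed.

Theorem proposition3 (R : realType) (alpha beta r : R)
    (alpha_gt0 : 0 < alpha) (beta_gt0 : 0 < beta) (r_gt0 : 0 < r) :
  (forall K : R, 0 < K ->
     Num.max (alpha * r) (2 * Num.sqrt (alpha * beta)) <= g alpha beta r K) /\
  (let K0 := Num.sqrt (beta / alpha) in
   g alpha beta r K0 = 2 * Num.sqrt (alpha * beta) + 2 * alpha * r /\
   exists m : R,
     is_min [set g alpha beta r K | K in [set K : R | 0 < K]] m /\
     2 * Num.sqrt (alpha * beta) + 2 * alpha * r <= 3 * m).
Proof.
have [[a0 b0] r0] := (ltW alpha_gt0, ltW beta_gt0, ltW r_gt0).
split=> [K K0|K0]; first by rewrite ge_max g_ge_mul ?g_ge_sqrt.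
split; first exact: g_sqrt_ratio.
have [c c0 crit] := g_critical_exists alpha_gt0 beta_gt0 r_gt0.
exists (g alpha beta r c); split; first split.
- by exists c.
- by move=> _ [K Kgt0 <-]; exact: g_critical_le.
- have := g_ge_mul a0 b0 r0 c0; have := g_ge_sqrt a0 b0 r0 c0; lra.
Qed.
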